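(* Let $\Gamma$ be a fixed split graph. Then there exists a polynomial $Q$ (depending only on $\Gamma$) such that every graph $G$ on $n$ vertices with no induced subgraph isomorphic to $\Gamma$ admits a CS-separator of size at most $Q(n)$.
   Context: A graph is split if its vertex set can be partitioned into a clique and a stable set. A cut of a graph $G=(V,E)$ is a pair $(A,B)$ with $A\cup B=V$ and $A\cap B=\emptyset$; it separates a clique $K$ and a stable set $S$ if $K\subseteq A$ and $S\subseteq B$. A CS-separator of $G$ is a family $\mathcal F$ of cuts such that for every clique $K$ and every stable set $S$ of $G$ with $K\cap S=\emptyset$, some cut of $\mathcal F$ separates $K$ and $S$. *)

(* Defs.v *)
From mathcomp Require Import all_boot all_order all_algebra.

Set Implicit Arguments.
Unset Strict Implicit.
Unset Printing Implicit Defensive.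

Record sgraph := SGraph {
  vertex :> finType;
  adj : rel vertex;
  adj_sym : symmetric adj;
  adj_irrefl : irreflexive adj }.

Definition isomorphic (G H : sgraph) : Prop :=
  exists2 f : G -> H, bijective f & forall x y, adj (f x) (f y) = adj x y.

Section Induced.
Variables (G : sgraph) (A : {set G}).

Definition induced_adj : rel {x : G | x \in A} :=
  fun u v => adj (val u) (val v).

Lemma induced_sym : symmetric induced_adj.
Proof. by move=> u v; apply: adj_sym. Qed.

Lemma induced_irrefl : irreflexive induced_adj.
Proof. by move=> u; apply: adj_irrefl. Qed.

Definition induced : sgraph := SGraph induced_sym induced_irrefl.
End Induced.

Definition induced_free (Gamma G : sgraph) : Prop :=
  ~ exists A : {set G}, isomorphic (induced A) Gamma.

Definition clique (G : sgraph) (K : {set G}) : Prop :=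
  {in K &, forall x y, x != y -> adj x y}.

Definition stable (G : sgraph) (S : {set G}) : Prop :=
  {in S &, forall x y, ~~ adj x y}.

(* The clique or the stable set may be empty. *)
Definition split_graph (G : sgraph) : Prop :=
  exists K S : {set G},
    [/\ clique K, stable S, K :|: S = [set: G] & K :&: S = set0].

Definition cut (G : sgraph) (c : {set G} * {set G}) : Prop :=
  c.1 :|: c.2 = [set: G] /\ c.1 :&: c.2 = set0.

Definition separates (G : sgraph) (c : {set G} * {set G}) (K S : {set G}) :
  Prop := K \subset c.1 /\ S \subset c.2.

Definition CS_separator (G : sgraph) (F : {set {set G} * {set G}}) : Prop :=
  (forall c, c \in F -> cut c) /\
  (forall K S : {set G}, clique K -> stable S -> K :&: S = set0 ->
     exists2 c, c \in F & separates c K S).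

(* Main.v *)
Require Import Defs.
From mathcomp Require Import all_boot all_order all_algebra.
From mathcomp Require Import zify ring lra.

Set Implicit Arguments.
Unset Strict Implicit.
Unset Printing Implicit Defensive.

Import Order.TTheory GRing.Theory Num.Theory.

(** Let [K] be a clique and [S] a stable set, disjoint, in a [Gamma]-free graph.
The non-adjacency relation between [K] and [S] and its dual cannot shatter
[#|Gamma|] points: on a shattered subset of one side every bipartite pattern is
realised, hence so is the one of [Gamma], and the edges inside the two parts are
forced. By linear programming duality there is either a weight on [K] giving
each vertex of [S] at least half of the mass as non-neighbours, or a weight on
[S] giving each vertex of [K] at least half of the mass as neighbours. By the
epsilon-net theorem a set of constantly many vertices then suffices: either
some [X] in [K], [#|X| <= m], such that no vertex of [S] is complete to [X], or
some [Y] in [S], [#|Y| <= m], such that each vertex of [K] has a neighbour in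
[Y]. So the cuts defined by the common closed neighbourhoods and by the unions
of neighbourhoods of the sets of at most [m] vertices are enough. *)

(** * Shattering and the Sauer-Shelah bound *)

(** A small set is recovered from the list of its elements padded with [None] to length [t], that is
    from a map ['I_t -> option T]. *)
Lemma card_small_sets (T : finType) (t : nat) :
  #|[set X : {set T} | #|X| <= t]| <= #|T|.+1 ^ t.
Proof.
pose im (f : {ffun 'I_t -> option T}) := [set x | Some x \in codom f].
apply: (@leq_trans #|[set im f | f : {ffun 'I_t -> option T}]|).
  apply/subset_leq_card/subsetP => X; rewrite inE => leXt.
  apply/imsetP; exists [ffun i : 'I_t => nth None (map some (enum X)) i] => //.
  apply/setP=> x; rewrite inE; apply/idP/codomP => [xX|[i]].
    have ltx : index x (enum X) < #|X| by rewrite cardE index_mem mem_enum.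
    exists (Ordinal (leq_trans ltx leXt)); rewrite ffunE /=.
    by rewrite (nth_map x) -?cardE // nth_index ?mem_enum.
  rewrite ffunE; have [lt_i | le_i] := ltnP i (size (enum X)); last first.
    by rewrite nth_default // size_map.
  by rewrite (nth_map x) // => -[->]; rewrite -mem_enum mem_nth.
by apply: leq_trans (leq_imset_card _ _) _; rewrite card_ffun card_option card_ord.
Qed.

Definition shatters (T : finType) (F : {set {set T}}) (X : {set T}) : bool :=
  powerset X \subset [set A :&: X | A in F].

Lemma shattersP (T : finType) (F : {set {set T}}) (X : {set T}) :
  reflect (forall Y : {set T}, Y \subset X -> exists2 A, A \in F & Y = A :&: X)
          (shatters F X).
Proof.
apply: (iffP subsetP) => [sh Y sYX | sh Y].
  by have /imsetP[A FA ->] := sh Y (etrans (powersetE _ _) sYX); exists A.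
by rewrite powersetE => /sh[A FA ->]; apply: imset_f.
Qed.

Lemma shattersW (T : finType) (F F' : {set {set T}}) (X : {set T}) :
  F \subset F' -> shatters F X -> shatters F' X.
Proof. by move=> sFF' sh; apply: subset_trans sh (imsetS _ sFF'). Qed.

Lemma shattersS (T : finType) (F : {set {set T}}) (X X' : {set T}) :
  X' \subset X -> shatters F X -> shatters F X'.
Proof.
move=> sX'X /shattersP sh; apply/shattersP => Y sYX'.
have [A FA defY] := sh Y (subset_trans sYX' sX'X); exists A => //.
by rewrite -(setIidPl sYX') defY -setIA (setIidPr sX'X).
Qed.

(* Pajor's form of the Sauer-Shelah lemma. *)
Lemma card_shatters (T : finType) (F : {set {set T}}) :
  #|F| <= #|[set X | shatters F X]|.
Proof.
have [n] := ubnP #|F|; elim: n F => // n IHn F /ltnSE leFn.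
have [leF1 | ltF1] := leqP #|F| 1.
  have [-> | [A FA]] := set_0Vmem F; first by rewrite cards0.
  apply: leq_trans leF1 _; apply/card_gt0P; exists set0; rewrite inE.
  apply/shattersP => Y; rewrite subset0 => /eqP->.
  by exists A; rewrite ?setI0.
have [x [A [B [FA FB xA xB]]]] :
    exists x A B, [/\ A \in F, B \in F, x \in A & x \notin B].
  have [A [B [FA FB neqAB]]] := card_gt1P ltF1.
  have := neqAB; rewrite eqEsubset negb_and => /orP[]/subsetPn[x xA xB].
    by exists x, A, B.
  by exists x, B, A.
pose F1 := [set C in F | x \in C]; pose F0 := [set C in F | x \notin C].
have defF : #|F| = #|F1| + #|F0|.
  rewrite -(cardsID [set C : {set T} | x \in C] F); congr (_ + _);
  by apply: eq_card => C; rewrite !inE // andbC.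
have F1gt0 : 0 < #|F1| by apply/card_gt0P; exists A; rewrite inE FA.
have F0gt0 : 0 < #|F0| by apply/card_gt0P; exists B; rewrite inE FB.
have le1 : #|F1| <= #|[set X | shatters F1 X]| by apply: IHn; lia.
have le0 : #|F0| <= #|[set X | shatters F0 X]| by apply: IHn; lia.
set S1 := [set X | shatters F1 X] in le1; set S0 := [set X | _] in le0.
(* Every member of [F1] contains [x] and no member of [F0] does, so neither family shatters a set
   containing [x]. *)
have xS1 X : X \in S1 -> x \notin X.
  rewrite inE => /shattersP/(_ _ (subD1set X x))[C].
  rewrite inE => /andP[_ xC] /setP/(_ x); rewrite !inE eqxx xC /= => <-.
  by [].
have xS0 X : X \in S0 -> x \notin X.
  rewrite inE => /shattersP/(_ _ (subxx X))[C].
  by rewrite inE => /andP[_ xC] ->; rewrite inE (negPf xC).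
pose S := [set X | shatters F X].
have sU : S1 :|: S0 \subset [set X in S | x \notin X].
  apply/subsetP=> X /setUP[] SX; rewrite inE ?(xS1 _ SX) ?(xS0 _ SX) andbT;
  move: SX; rewrite !inE; apply: shattersW;
  by apply/subsetP=> C; rewrite inE => /andP[].
(* A set shattered by both families counts once more with [x] added: [F1] gives the traces with [x],
   [F0] those without. Hence [#|S1| + #|S0| <= #|S|]. *)
have sI : [set x |: X | X in S1 :&: S0] \subset [set X in S | x \in X].
  apply/subsetP=> _ /imsetP[X /setIP[S1X S0X] ->].
  rewrite inE setU11 andbT inE; apply/shattersP => Y sY.
  have sYX : Y :\ x \subset X by rewrite subDset.
  have [xY | xY] := boolP (x \in Y).
    move: S1X; rewrite inE => /shattersP/(_ _ sYX)[C].
    rewrite inE => /andP[FC xC] defY; exists C => //.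
    rewrite setIUr -defY (setIidPr _) ?sub1set // setD1K //.
  move: S0X; rewrite inE => /shattersP/(_ _ sYX)[C].
  rewrite inE => /andP[FC xC] defY; exists C => //.
  rewrite setIUr -defY; have -> : C :&: [set x] = set0.
    by apply/setP=> y; rewrite !inE; case: eqP => [->|]; rewrite ?andbF ?(negPf xC).
  by rewrite set0U; apply/setP=> y; rewrite !inE; case: eqP => // ->; rewrite (negPf xY).
have injx : {in S1 :&: S0 &, injective (fun X => x |: X)}.
  move=> X X' /setIP[/xS1 xX _] /setIP[/xS1 xX' _] /(congr1 (fun Z => Z :\ x)).
  by rewrite !setU1K.
have defS : #|S| = #|[set X in S | x \in X]| + #|[set X in S | x \notin X]|.
  rewrite -(cardsID [set C : {set T} | x \in C] S); congr (_ + _);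
  by apply: eq_card => C; rewrite !inE // andbC.
have := subset_leq_card sU; have := subset_leq_card sI.
rewrite card_in_imset // -/S => leI leU.
have := cardsUI S1 S0.
lia.
Qed.

(** * Set systems defined by a relation, and their VC dimension *)

Definition traces (A B : finType) (r : A -> B -> bool) : {set {set A}} :=
  [set [set a | r a b] | b : B].

Lemma shatters_tracesP (A B : finType) (r : A -> B -> bool) (X : {set A}) :
  reflect (forall Y : {set A}, exists b, {in X, forall a, r a b = (a \in Y)})
          (shatters (traces r) X).
Proof.
apply: (iffP (shattersP _ _)) => sh Y.
  have [_ /imsetP[b _ ->] defY] := sh _ (subsetIr Y X); exists b => a aX.
  by have /setP/(_ a) := defY; rewrite !inE aX !andbT.
move=> sYX; have [b rb] := sh Y; exists [set a | r a b]; first exact: imset_f.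
apply/setP=> a; rewrite !inE; have [aX | aX] := boolP (a \in X).
  by rewrite rb ?andbT.
by rewrite andbF; apply: contraNF aX; apply: (subsetP sYX).
Qed.

(** Points with the same image under [h] lie in the same traces, so [h] is injective on a shattered
    set. *)
Lemma shatters_preim (A A' B : finType) (r : A -> B -> bool) (h : A' -> A)
    (X : {set A'}) :
  shatters (traces (fun a' b => r (h a') b)) X ->
  #|h @: X| = #|X| /\ shatters (traces r) (h @: X).
Proof.
move/shatters_tracesP => sh; split.
  apply: card_in_imset => a1 a2 X1 X2 eq_h; have [b rb] := sh [set a2].
  by apply/set1P; rewrite -rb // eq_h rb // set11.
apply/shatters_tracesP=> Y; have [b rb] := sh (h @^-1: Y).
by exists b => _ /imsetP[a' Xa' ->]; rewrite rb // inE.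
Qed.

(** The VC dimension is less than [d]: since subsets of shattered sets are shattered, size exactly
    [d] is enough. *)
Definition vc_bounded (A B : finType) (r : A -> B -> bool) (d : nat) : Prop :=
  forall X : {set A}, #|X| = d -> ~~ shatters (traces r) X.

Lemma vc_bounded_preim (A A' B : finType) (r : A -> B -> bool) (h : A' -> A) d :
  vc_bounded r d -> vc_bounded (fun a' b => r (h a') b) d.
Proof.
move=> vc X cardX; apply/negP => /shatters_preim[cardhX].
by apply/negP/vc; rewrite cardhX.
Qed.

Lemma card_traces (A B : finType) (r : A -> B -> bool) d :
  vc_bounded r d -> #|traces r| <= #|A|.+1 ^ d.
Proof.
move=> vc; apply: leq_trans (card_shatters _) _.
apply: leq_trans (card_small_sets _ _); apply/subset_leq_card/subsetP=> X.
rewrite !inE => sh; rewrite leqNgt; apply/negP => ltdX.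
have [X' sX'X cardX'] : exists2 X' : {set A}, X' \subset X & #|X'| = d.
  exists [set x in take d (enum X)].
    by apply/subsetP=> x; rewrite inE => /mem_take; rewrite mem_enum.
  rewrite cardsE (card_uniqP _) ?take_uniq ?enum_uniq // size_takel //.
  by rewrite -cardE ltnW.
by have /negP := vc _ cardX'; apply; apply: shattersS sh.
Qed.

(** * Epsilon-nets *)

(** This picks the net size: [m.*2.+1 ^ d] will bound the traces on a sample of [2 m] points, and
    [(7/8)^m] the share of index maps avoiding a given large trace. *)
Lemma exp_dominates_poly (d : nat) :
  exists m, 8 * m.*2.+1 ^ d * 7 ^ m < 8 ^ m.
Proof.
(* The factor 7 is there because [2 * 7 ^ 7 <= 8 ^ 7], so [(8/7)^m] is at least [2 ^ k]; [j] is
   large enough for [2 ^ k] to beat the polynomial factor. *)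
pose j := d.*2 + 5; pose k := 2 ^ j; exists (7 * k).
have le7 : 2 ^ k * 7 ^ (7 * k) <= 8 ^ (7 * k).
  have le2 : 2 * 7 ^ 7 <= 8 ^ 7 by rewrite !expnS !expn0; lia.
  by rewrite !expnM -expnMn; rewrite leq_exp2r ?le2 ?expn_gt0.
apply: leq_trans le7; rewrite ltn_pmul2r ?expn_gt0 //.
have lej : (7 * k).*2.+1 <= 2 ^ (j + 4).
  have : 0 < k by rewrite expn_gt0.
  by rewrite expnD -/k; lia.
have lt_j : (j + 4) * d + 3 < k.
  have : d < 2 ^ d by apply: ltn_expl.
  have -> : k = 2 ^ d * 2 ^ d * 32 by rewrite /k /j -addnn !expnD.
  rewrite /j; move: (2 ^ d) => e; nia.
have : 8 * (7 * k).*2.+1 ^ d <= 2 ^ ((j + 4) * d + 3).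
  rewrite addnC expnD expnM leq_mul //.
  by have [-> // | d_gt0] := posnP d; rewrite leq_exp2r.
by move/leq_ltn_trans; apply; rewrite ltn_exp2l.
Qed.

Lemma card_set_sum (T : finType) (P : pred T) :
  #|[set x | P x]| = \sum_x nat_of_bool (P x).
Proof.
rewrite -sum1_card big_mkcond; apply: eq_bigr => x _.
by rewrite inE; case: (P x).
Qed.

(** Exchanging the coordinate [w j] with a fresh point [a] is an involution on pairs [(w, a)], and
    it does not affect [P w]. *)
Lemma resample (A : finType) n (j : 'I_n) (P : {ffun 'I_n -> A} -> pred A) :
  (forall w w' : {ffun 'I_n -> A},
     {in predC1 j, w =1 w'} -> P w =1 P w') ->
  #|A| * #|[set w : {ffun 'I_n -> A} | P w (w j)]| =
  \sum_(w : {ffun 'I_n -> A}) #|[set a | P w a]|.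
Proof.
move=> Pindep; pose upd (w : {ffun 'I_n -> A}) a : {ffun 'I_n -> A} :=
  [ffun k => if k == j then a else w k].
pose swap (p : {ffun 'I_n -> A} * A) := (upd p.1 p.2, p.1 j).
have swapK : involutive swap.
  case=> w a; rewrite /swap /= ffunE eqxx; congr (_, _).
  by apply/ffunP=> k; rewrite !ffunE; case: eqP => // ->.
have updP w a : P (upd w a) =1 P w.
  by apply: Pindep => k; rewrite inE ffunE => /negPf->.
transitivity (\sum_(w : {ffun 'I_n -> A}) \sum_(a : A) nat_of_bool (P w (w j))).
  rewrite mulnC -sum1_card big_distrl /= big_mkcond /=; apply: eq_bigr => w _.
  by rewrite inE sum_nat_const; case: (P w _); rewrite ?mul1n ?muln1 ?muln0.
rewrite pair_big /= (reindex_inj (inv_inj swapK)) /=.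
rewrite -(pair_big xpredT xpredT (fun w a => nat_of_bool (P (upd w a) (upd w a j)))) /=.
apply: eq_bigr => w _; rewrite -sum1_card [RHS]big_mkcond /=.
by apply: eq_bigr => a _; rewrite inE updP ffunE eqxx; case: (P w a).
Qed.

(* If no set of [m] points is a net, choose for each [y] in [A ^ m] some [F y]
missed by [y]. Count triples [(w, i, j)], for [w] in [A ^ n], [n = 2 m], an index
map [i : 'I_m -> 'I_n] and [j : 'I_n], such that [w j] is hit by [F (w \o i)].
When [j] is not in the image of [i], the point [w j] is independent of
[F (w \o i)], so there are many triples. But for fixed [w] the sets of such [j]
are among the at most [(n + 1) ^ d] traces on [w], and [i] avoids its own
trace, so that few [i] have a trace of more than [n / 8] elements. *)
Lemma epsilon_net (A B : finType) (r : A -> B -> bool) d m :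
  8 * m.*2.+1 ^ d * 7 ^ m < 8 ^ m ->
  0 < #|A| -> vc_bounded r d ->
  (forall b, #|A| <= 2 * #|[set a | r a b]|) ->
  exists2 X : {set A}, #|X| <= m & forall b, exists2 a, a \in X & r a b.
Proof.
move=> lt_m A_gt0 vc big_r; set N := #|A| in A_gt0 big_r.
have [/existsP[X /andP[leXm /forallP hitX]] | noX] :=
    boolP [exists X : {set A}, (#|X| <= m) &&
             [forall b, [exists a, (a \in X) && r a b]]].
  by exists X => // b; have /existsP[a /andP[]] := hitX b; exists a.
have /fin_all_exists[F missF] (y : {ffun 'I_m -> A}) :
    exists b, forall i, ~~ r (y i) b.
  have := noX; rewrite negb_exists => /forallP/(_ (y @: [set: 'I_m])).
  rewrite (leq_trans (leq_imset_card _ _)) ?cardsT ?card_ord //=.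
  rewrite negb_forall => /existsP[b]; rewrite negb_exists => /forallP mb.
  by exists b => i; have := mb (y i); rewrite imset_f.
have m_gt0 : 0 < m.
  by rewrite lt0n; apply: contraL lt_m => /eqP->; rewrite exp1n.
pose n := m.*2.
pose sub (w : {ffun 'I_n -> A}) (i : {ffun 'I_m -> 'I_n}) : {ffun 'I_m -> A} :=
  [ffun k => w (i k)].
pose hits (w : {ffun 'I_n -> A}) (i : {ffun 'I_m -> 'I_n}) :=
  [set j | r (w j) (F (sub w i))].
pose Z := \sum_(w : {ffun 'I_n -> A}) \sum_(i : {ffun 'I_m -> 'I_n}) #|hits w i|.
(* At least [n - m = m] indices [j] lie outside the image of [i], and each is hit for at least half
   of the samples [w]. *)
have lowerZ : n ^ m * (m * N ^ n) <= 2 * Z.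
  rewrite /Z exchange_big big_distrr /= -[n in n ^ m]card_ord -[m in _ ^ m]card_ord.
  rewrite -card_ffun -sum_nat_const; apply: leq_sum => i _.
  have -> : \sum_(w : {ffun 'I_n -> A}) #|hits w i| =
      \sum_j #|[set w : {ffun 'I_n -> A} | r (w j) (F (sub w i))]|.
    rewrite (eq_bigr _ (fun w _ => card_set_sum _)) exchange_big /=.
    by apply: eq_bigr => j _; rewrite card_set_sum.
  rewrite (bigID [in i @: [set: 'I_m]]) /=.
  apply: leq_trans (leq_mul (leqnn 2) (leq_addl _ _)); rewrite big_distrr /=.
  apply: (@leq_trans (#|~: (i @: [set: 'I_m])| * N ^ n)).
    rewrite leq_mul2r cardsCs setCK card_ord; apply/orP; right.
apply: (@leq_trans (n - m)); first by rewrite /n -addnn addnK.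
    by rewrite leq_sub2l // (leq_trans (leq_imset_card _ _)) // cardsT card_ord.
  rewrite -sum_nat_const (eq_bigl [pred j | j \notin i @: [set: 'I_m]]); last first.
    by move=> j; apply: in_setC.
  apply: leq_sum => j /= im_j.
  rewrite -(leq_pmul2l A_gt0) mulnCA.
  rewrite (@resample _ _ j (fun w a => r a (F (sub w i)))); last first.
    move=> w w' eqw a; congr (r a (F _)); apply/ffunP=> k; rewrite !ffunE.
    by apply: eqw; rewrite inE; apply: contraNneq im_j => <-; rewrite imset_f.
  rewrite big_distrr /= mulnC -[n in N ^ n]card_ord -card_ffun -sum_nat_const.
  by apply: leq_sum => w _; apply: big_r.
have upperZ w : 8 * (\sum_(i : {ffun 'I_m -> 'I_n}) #|hits w i|) < 2 * n * n ^ m.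
  pose W := traces (fun j b => r (w j) b).
  have leW : #|W| <= n.+1 ^ d.
    by rewrite -[n in n.+1]card_ord; apply/card_traces/vc_bounded_preim.
  pose bad := [set i | n < 8 * #|hits w i|].
  (* Union bound over the large traces: an index map avoiding one has at most [7 n / 8] choices for
     each of its [m] values. *)
  have le_bad : 8 ^ m * #|bad| <= #|W| * (7 * n) ^ m.
    apply: (@leq_trans (\sum_(X in W | n < 8 * #|X|)
       8 ^ m * #|[set i : {ffun 'I_m -> 'I_n} | [forall k, i k \notin X]]|)).
      rewrite -big_distrr leq_mul2l; apply/orP; right.
      apply: (@leq_trans #|\bigcup_(X in W | n < 8 * #|X|)
         [set i : {ffun 'I_m -> 'I_n} | [forall k, i k \notin X]]|).
        apply/subset_leq_card/subsetP=> i; rewrite inE => bad_i.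
        apply/bigcupP; exists (hits w i).
          by rewrite bad_i andbT; apply/imsetP; exists (F (sub w i)).
        rewrite inE; apply/forallP=> k; rewrite inE.
        by have := missF (sub w i) k; rewrite ffunE.
      apply: (big_ind2 (fun (U : {set {ffun 'I_m -> 'I_n}}) k => #|U| <= k)) => //.
        by rewrite cards0.
      move=> U k U' k' leU leU'; apply: leq_trans (leq_card_setU _ _) _.
      exact: leq_add.
    rewrite -sum_nat_const [leqRHS](bigID (fun X : {set 'I_n} => n < 8 * #|X|)) /=.
    apply: leq_trans (leq_addr _ _); apply: leq_sum => X /andP[_ bigX].
    have -> : #|[set i : {ffun 'I_m -> 'I_n} | [forall k, i k \notin X]]| =
              #|~: X| ^ m.
      rewrite -[m in RHS]card_ord -card_ffun_on; apply: eq_card => i; rewrite inE.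
      by apply/forallP/ffun_onP => iX k; have := iX k; rewrite inE.
    rewrite -expnMn leq_exp2r // cardsCs setCK card_ord.
    suff le7 k : n < 8 * k -> 8 * (n - k) <= 7 * n by apply: le7.
    lia.
  have lt_bad : 8 * #|bad| < n ^ m.
    have n_gt0 : 0 < n ^ m by rewrite expn_gt0 double_gt0 m_gt0.
    rewrite -(@ltn_pmul2l (8 ^ m)) ?expn_gt0 // mulnCA.
    have le_bad8 := leq_trans le_bad (leq_mul leW (leqnn _)).
    apply: leq_ltn_trans (leq_mul (leqnn 8) le_bad8) _.
    by rewrite expnMn !mulnA ltn_pmul2r.
  (* A map that is not bad contributes at most [n / 8], a bad one at most [n]. *)
  have : 8 * (\sum_i #|hits w i|) <=
      \sum_(i : {ffun 'I_m -> 'I_n}) n + 8 * \sum_(i in bad) n.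
    apply: (@leq_trans
      (\sum_(i : {ffun 'I_m -> 'I_n}) (n + 8 * (if i \in bad then n else 0)))); last first.
      by rewrite big_split -big_distrr -big_mkcond.
    rewrite big_distrr.
    apply: leq_sum => i _; rewrite inE.
    have le8 k : k <= n -> 8 * k <= n + 8 * (if n < 8 * k then n else 0).
      by case: ltnP; lia.
    by apply: le8; apply: leq_trans (max_card _) _; rewrite card_ord.
  rewrite !sum_nat_const card_ffun !card_ord => /leq_ltn_trans; apply.
  have n_gt0 : 0 < n by rewrite double_gt0.
  move: (n ^ m) lt_bad => q; nia.
have : 8 * Z < N ^ n * (2 * n * n ^ m).
  rewrite /Z big_distrr /= -[n in N ^ n]card_ord -card_ffun -sum_nat_const.
  (* A point of [A] provides a sample, so the strict bound survives the summation over [w]. *)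
  have /card_gt0P[a0 _] := A_gt0.
  rewrite [ltnLHS](bigD1 [ffun=> a0]) //= [ltnRHS](bigD1 [ffun=> a0]) //=.
  by rewrite -addSn leq_add // leq_sum // => w _; apply: ltnW.
rewrite /n in lowerZ *; move: (N ^ _) (_ ^ m) lowerZ => p q; nia.
Qed.

(** Replacing each [a] by [w a] copies turns weights into cardinalities and keeps the VC bound. *)
Lemma weighted_epsilon_net (A B : finType) (r : A -> B -> bool) (w : A -> nat) d m :
  8 * m.*2.+1 ^ d * 7 ^ m < 8 ^ m ->
  0 < \sum_a w a -> vc_bounded r d ->
  (forall b, \sum_a w a <= 2 * \sum_(a | r a b) w a) ->
  exists2 X : {set A}, #|X| <= m & forall b, exists2 a, a \in X & r a b.
Proof.
move=> lt_m w_gt0 vc big_r; pose T := {a : A & 'I_(w a)}.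
have cardT (P : pred A) : #|[set t : T | P (tag t)]| = \sum_(a | P a) w a.
  rewrite -sum1_card.
  transitivity (\sum_(a | P a) \sum_(i < w a) 1).
    rewrite (sig_big_dep P (fun _ => xpredT) (fun _ _ => 1)) /=.
    by apply: eq_bigl => t; rewrite inE andbT.
  by apply: eq_bigr => a _; rewrite sum_nat_const card_ord muln1.
have cardT' : #|{: T}| = \sum_a w a by rewrite -(cardT xpredT) cardsT.
have [|||X leXm hitX] := epsilon_net lt_m (r := fun (t : T) b => r (tag t) b).
- by rewrite cardT'.
- exact: vc_bounded_preim.
- by move=> b; rewrite cardT' (cardT (r^~ b)).
exists [set tag t | t in X] => [|b].
  exact: leq_trans (leq_imset_card _ _) _.
by have [t Xt rtb] := hitX b; exists (tag t); rewrite ?imset_f.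
Qed.

(** * Linear programming duality *)

Section LinearDuality.
Local Open Scope ring_scope.

(** It supplies the new multiplier in an elimination step, where either list of bounds may be
    empty. *)
Lemma exists_between (R : realFieldType) (ls us : seq R) :
  {in ls & us, forall l u, l < u} ->
  exists x, {in ls, forall l, l < x} /\ {in us, forall u, x < u}.
Proof.
elim: us => [_ | u us IHus lt_lu].
  elim: ls => [|l ls [x [ltx _]]]; first by exists 0.
  exists (Num.max x (l + 1)); split=> // l'; rewrite inE lt_max.
  by case/predU1P=> [-> | /ltx ->] //; rewrite ltrDl ltr01 orbT.
have [x [ltlx ltxu]] : exists x,
    {in ls, forall l, l < x} /\ {in us, forall u, x < u}.
  by apply: IHus => l v lsl usv; rewrite lt_lu // inE usv orbT.
have [y [ltly ltyu]] : exists y, {in ls, forall l, l < y} /\ y < u.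
  elim: ls lt_lu {IHus ltlx} => [|l ls IHls] lt_lu.
    by exists (u - 1); split=> //; rewrite ltrBlDr ltrDl.
  have [y [lty ltyu]] : exists y, {in ls, forall l, l < y} /\ y < u.
    by apply: IHls => l' v ls' uv; rewrite lt_lu // in_cons ls' orbT.
  have ltlu : l < u by rewrite lt_lu ?inE ?eqxx.
  exists (Num.max y ((l + u) / 2)); split; last by rewrite gt_max ltyu; lra.
  move=> l'; rewrite inE lt_max => /predU1P[-> | /lty-> //].
  by apply/orP; right; lra.
exists (Num.min x y); split=> [l lsl | v].
  by rewrite lt_min ltlx ?ltly.
by rewrite inE gt_min => /predU1P[->| /ltxu->//]; rewrite ltyu orbT.
Qed.

(* Fourier-Motzkin elimination on the functionals [phi b], in the dual form that
transforms the generators: a generator with [phi b > 0] and one with [phi b < 0]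
are mixed into one with [phi b = 0]. *)
Lemma cone_alternative (R : realFieldType) (V : lmodType R) (B : eqType)
    (phi : B -> V -> R) (s : seq B) (C : V -> Prop) (G : seq V) :
  (forall b x y u v, phi b (x *: u + y *: v) = x * phi b u + y * phi b v) ->
  uniq s ->
  (forall x y u v, 0 < x -> 0 < y -> C u -> C v -> C (x *: u + y *: v)) ->
  {in G, forall g, C g} ->
  (exists2 w, C w & {in s, forall b, 0 <= phi b w}) \/
  (exists2 mu : B -> R, (forall b, 0 <= mu b) &
     {in G, forall g, \sum_(b <- s) mu b * phi b g < 0}).
Proof.
move=> phiE; elim: s C G => [|b s IHs] C G /=.
  case: G => [|g G] _ _ CG; last first.
    by left; exists g => //; apply: CG; apply: mem_head.
  by right; exists (fun=> 0).
case/andP=> sb uniq_s convC CG.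
pose mix u v := phi b u *: v + (- phi b v) *: u.
pose pos := [seq g <- G | 0 < phi b g]; pose neg := [seq g <- G | phi b g < 0].
(* The induction hypothesis is applied to the part of [C] where [phi b] is nonnegative; [phi b]
   vanishes on each [mix u v]. *)
pose G' := [seq g <- G | 0 <= phi b g] ++ [seq mix u v | u <- pos, v <- neg].
have [|| [w [Cw phiw] sw] | [mu mu_ge0 mu_lt0]] :=
    IHs (fun w => C w /\ 0 <= phi b w) G' uniq_s.
- move=> x y u v x_gt0 y_gt0 [Cu bu] [Cv bv]; split; first exact: convC.
  rewrite phiE.  nra.
- move=> g; rewrite mem_cat => /orP[|/allpairsP[[u v] /= [upos vneg ->]]].
    by rewrite mem_filter => /andP[? /CG].
  move: upos vneg; rewrite !mem_filter => /andP[bu /CG Cu] /andP[bv /CG Cv].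
  split; first by apply: convC => //; rewrite oppr_gt0.
  by rewrite phiE; nra.
- left; exists w => // c; rewrite inE => /predU1P[-> //|]; exact: sw.
right; pose beta g := \sum_(c <- s) mu c * phi c g.
have betaP x y u v : beta (x *: u + y *: v) = x * beta u + y * beta v.
  rewrite /beta !mulr_sumr -big_split; apply: eq_bigr => c _ /=.
  by rewrite phiE; ring.
have beta_ge g : g \in G -> 0 <= phi b g -> beta g < 0.
  by move=> Gg bg; apply: mu_lt0; rewrite mem_cat mem_filter bg Gg.
(* The multiplier [z] of [b] must satisfy [z * phi b g + beta g < 0] on [G]: an upper bound from
   each [g] in [pos], a lower one from each in [neg]. The bounds of [g] and [h] are compatible
   because [beta (mix g h) < 0]. *)
have [z [ltz zlt]] : exists z,
    {in 0 :: [seq beta g / - phi b g | g <- neg], forall l, l < z} /\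
    {in [seq - beta g / phi b g | g <- pos], forall u, z < u}.
  apply: exists_between => l u ll /mapP[g]; rewrite mem_filter => /andP[bg Gg] ->.
  have := ll; rewrite inE => /predU1P[->|/mapP[h]].
    by rewrite divr_gt0 // oppr_gt0 beta_ge // ltW.
  rewrite mem_filter => /andP[bh Gh] ->.
  have bh' : 0 < - phi b h by rewrite oppr_gt0.
  rewrite ltr_pdivrMr // mulrAC ltr_pdivlMr //.
  have /mu_lt0 : mix g h \in G'.
    rewrite mem_cat; apply/orP; right; apply/allpairsP; exists (g, h).
    by rewrite !mem_filter bg bh.
  by rewrite -/(beta _) betaP; lra.
have z_gt0 : 0 < z by rewrite ltz ?mem_head.
exists (fun c => if c == b then z else mu c) => [c|g Gg].
  by case: eqP => // _; rewrite ltW.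
rewrite big_cons eqxx.
have -> : \sum_(c <- s) (if c == b then z else mu c) * phi c g = beta g.
  apply: eq_big_seq => c sc; case: eqP => // eq_cb.
  by rewrite -eq_cb sc in sb.
have [bg | bg | bg] := ltrgt0P (phi b g).
- have /zlt : - beta g / phi b g \in [seq - beta g / phi b g | g <- pos].
    by apply: map_f; rewrite mem_filter bg.
  by rewrite ltr_pdivlMr //; lra.
- have /ltz : beta g / - phi b g \in 0 :: [seq beta g / - phi b g | g <- neg].
    rewrite inE; apply/orP; right; apply: (map_f (fun g => beta g / - phi b g)).
    by rewrite mem_filter bg.
  by rewrite ltr_pdivrMr ?oppr_gt0 //; lra.
- by rewrite bg mulr0 add0r beta_ge ?bg.
Qed.

Lemma clear_denominators (A : finType) (w : A -> rat) :
  (forall a, 0 <= w a) ->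
  exists2 D : nat, (0 < D)%N &
    exists v : A -> nat, forall a, (v a)%:R = D%:R * w a.
Proof.
move=> w_ge0; pose D := (\prod_a `|denq (w a)|)%N.
exists D; first by rewrite prodn_gt0 // => a; rewrite absz_gt0 denq_eq0.
exists (fun a => (`|numq (w a)| * (\prod_(b | b != a) `|denq (w b)|))%N) => a.
have -> : D = (`|denq (w a)| * \prod_(b | b != a) `|denq (w b)|)%N.
  by rewrite /D (bigD1 a).
rewrite !natrM !natr_absz !ger0_norm ?denq_ge0 ?numq_ge0 // numqE.
ring.
Qed.


(** Duality for the matrix with entries 1 where [r] holds and -1 elsewhere: a nonnegative [phi b w]
    means that at least half of the mass of [w] is related to [b]. *)
Lemma halving_weights (A B : finType) (r : A -> B -> bool) : (0 < #|A|)%N ->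
  (exists2 w : A -> nat, (0 < \sum_a w a)%N &
     forall b, (\sum_a w a <= 2 * \sum_(a | r a b) w a)%N) \/
  (exists2 w : B -> nat, (0 < \sum_b w b)%N &
     forall a, (\sum_b w b <= 2 * \sum_(b | ~~ r a b) w b)%N).
Proof.
move=> /card_gt0P[a0 _].
pose sgn a b : rat := if r a b then 1 else -1.
pose phi b (w : {ffun A -> rat^o}) : rat := \sum_a w a * sgn a b.
pose C (w : {ffun A -> rat^o}) := (forall a, 0 <= w a) /\ 0 < \sum_a (w a : rat).
pose delta c : {ffun A -> rat^o} := [ffun a => (a == c)%:R].
have sum_delta c (F : A -> rat) : \sum_a (delta c a : rat) * F a = F c.
  rewrite (bigD1 c) //= ffunE eqxx mul1r big1 ?addr0 // => a /negPf neq_ac.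
  by rewrite ffunE neq_ac mul0r.
have [|||| [w [w_ge0 w_gt0] phiw] | [mu mu_ge0 mu_lt0]] :=
    @cone_alternative _ _ _ phi (enum B) C [seq delta c | c <- enum A].
- move=> b x y u v; rewrite /phi !mulr_sumr -big_split; apply: eq_bigr => a _ /=.
  by rewrite !ffunE /GRing.scale /=; ring.
- exact: enum_uniq.
- move=> x y u v x_gt0 y_gt0 [u_ge0 u_gt0] [v_ge0 v_gt0]; split=> [a|].
    by rewrite !ffunE addr_ge0 // mulr_ge0 // ltW.
  have -> : \sum_a ((x *: u + y *: v) a : rat) =
            x * (\sum_a (u a : rat)) + y * (\sum_a (v a : rat)).
    by rewrite !mulr_sumr -big_split; apply: eq_bigr => a _ /=; rewrite !ffunE.
  by rewrite addr_gt0 // mulr_gt0.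
- move=> _ /mapP[c _ ->]; split=> [a|]; first by rewrite ffunE ler0n.
  have := sum_delta c (fun=> 1); under eq_bigr do rewrite mulr1.
  by move->; apply: ltr01.
- left; have [D D_gt0 [v vE]] := clear_denominators w_ge0.
  have vsum (P : pred A) : (\sum_(a | P a) v a)%:R = D%:R * \sum_(a | P a) (w a : rat).
    by rewrite natr_sum mulr_sumr; apply: eq_bigr.
  exists v => [|b]; first by rewrite -(ltr_nat rat) vsum mulr_gt0 // ltr0n.
  rewrite -(ler_nat rat) natrM !vsum mulrCA ler_pM2l ?ltr0n //.
  have := phiw b (mem_enum _ _); rewrite /phi (bigID (r^~ b)) /=.
  rewrite (eq_bigr (fun a => w a : rat)) => [|a rab]; last by rewrite /sgn rab mulr1.
  rewrite [X in _ + X](eq_bigr (fun a => - (w a : rat))) => [|a /negPf rab]; last first.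
    by rewrite /sgn rab mulrN1.
  rewrite sumrN [X in _ -> X <= _](bigID (r^~ b)) /=.
  by move=> ?; lra.
right; have [D D_gt0 [v vE]] := clear_denominators mu_ge0.
have vsum (P : pred B) : (\sum_(b | P b) v b)%:R = D%:R * \sum_(b | P b) mu b.
  by rewrite natr_sum mulr_sumr; apply: eq_bigr.
have lt0 a : \sum_b mu b * sgn a b < 0.
  (* Evaluating at the unit vector of [a] reads off row [a] of the matrix. *)
  have /mu_lt0 : delta a \in [seq delta c | c <- enum A] by rewrite map_f ?mem_enum.
  by rewrite big_enum /=; under eq_bigr do rewrite /phi sum_delta.
have {}lt0 a : \sum_(b | r a b) mu b < \sum_(b | ~~ r a b) mu b.
  have := lt0 a; rewrite (bigID (r a)) /=.
  rewrite (eq_bigr mu) => [|b rab]; last by rewrite /sgn rab mulr1.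
  rewrite [X in _ + X](eq_bigr (fun b => - mu b)) => [|b /negPf rab]; last first.
    by rewrite /sgn rab mulrN1.
  by rewrite sumrN subr_lt0.
have sum_split a : \sum_b mu b = \sum_(b | r a b) mu b + \sum_(b | ~~ r a b) mu b.
  by rewrite (bigID (r a)).
exists v => [|a].
  rewrite -(ltr_nat rat) vsum mulr_gt0 ?ltr0n // (sum_split a0).
  have : 0 <= \sum_(b | r a0 b) mu b by apply: sumr_ge0.
  by have := lt0 a0; lra.
rewrite -(ler_nat rat) natrM !vsum mulrCA ler_pM2l ?ltr0n // (sum_split a).
by have := lt0 a; lra.
Qed.

End LinearDuality.

(** * Bounded domination on one of the two sides *)

(** Duality puts a halving weight on one side, and the net theorem applies there. As [m] depends on
    [d] alone, it can serve as the degree of the polynomial. *)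
Lemma bounded_domination d : exists m, forall (A B : finType) (r : A -> B -> bool),
  vc_bounded r d -> vc_bounded (fun b a => ~~ r a b) d ->
  (exists2 X : {set A}, #|X| <= m & forall b, exists2 a, a \in X & r a b) \/
  (exists2 Y : {set B}, #|Y| <= m & forall a, exists2 b, b \in Y & ~~ r a b).
Proof.
have [m lt_m] := exp_dominates_poly d; exists m => A B r vcA vcB.
have [/eqP A0 | A_gt0] := posnP #|A|.
  right; exists set0; first by rewrite cards0.
  by move=> a; have := fintype0 a; rewrite (eqP A0).
have [[w w_gt0 big_r] | [w w_gt0 big_r]] := halving_weights r A_gt0.
  by left; apply: weighted_epsilon_net lt_m w_gt0 vcA big_r.
by right; apply: weighted_epsilon_net lt_m w_gt0 vcB big_r.
Qed.

(** * Shattering yields induced copies of a split graph *)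

Lemma induced_freePn (Gamma G : sgraph) (f : Gamma -> G) :
  injective f -> (forall x y, adj (f x) (f y) = adj x y) ->
  ~ induced_free Gamma G.
Proof.
move=> inj_f adj_f; apply; exists (f @: [set: Gamma]).
pose g (u : Gamma) : induced (f @: [set: Gamma]) :=
  exist _ (f u) (imset_f f (in_setT u)).
have inj_g : injective g by move=> u v /(congr1 val) /inj_f.
have [h gK hK] : bijective g.
  apply: inj_card_bij => //.
  apply: (@leq_trans #|f @: [set: Gamma]|); last by rewrite card_imset // cardsT.
  by rewrite card_sig; apply/subset_leq_card/subsetP.
exists h => [|x y]; first by exists g.
by rewrite -[in RHS](hK x) -[in RHS](hK y) -adj_f.
Qed.

(** Adjacency inside the clique and inside the stable set is forced, so only the pairs across have
    to be controlled. *)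
Lemma split_embedding (Gamma G : sgraph) (K : {set Gamma}) (K' S' : {set G})
    (f : Gamma -> G) :
  clique K -> stable (~: K) -> clique K' -> stable S' -> injective f ->
  (forall u, if u \in K then f u \in K' else f u \in S') ->
  {in K & ~: K, forall u v, adj (f u) (f v) = adj u v} ->
  ~ induced_free Gamma G.
Proof.
move=> cK sK cK' sS' inj_f fP adj_f; apply: (induced_freePn inj_f) => u v.
have := fP u; have := fP v.
have [vK | vK] := boolP (v \in K); have [uK | uK] := boolP (u \in K) => fv fu.
- have [-> | neq_uv] := eqVneq u v; first by rewrite !adj_irrefl.
  by rewrite cK // cK' // (inj_eq inj_f).
- by rewrite adj_sym [RHS]adj_sym adj_f // inE.
- by rewrite adj_f // inE.
by rewrite (negPf (sK _ _ _ _)) ?inE // (negPf (sS' _ _ _ _)).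
Qed.

Lemma enum_embedding (Gamma T : finType) (X : {set T}) :
  #|X| = #|Gamma| -> exists2 e : Gamma -> T, injective e & forall u, e u \in X.
Proof.
move=> cardX; exists (fun u => enum_val (cast_ord (esym cardX) (enum_rank u))).
  by move=> u v /enum_val_inj/cast_ord_inj/enum_rank_inj.
by move=> u; apply: enum_valP.
Qed.

Lemma disjoint_sets_absurd (T : finType) (K S : {set T}) x :
  K :&: S = set0 -> x \in K -> x \in S -> False.
Proof. by move=> disjKS xK xS; have := in_set0 x; rewrite -disjKS inE xK xS. Qed.

(** In a copy of [Gamma], the clique part is placed on a shattered subset of [K], and the other
    vertices on points of [S] realising the required traces. *)
Lemma vc_clique (Gamma G : sgraph) (K0 : {set Gamma}) (K S : {set G}) :
  clique K0 -> stable (~: K0) -> clique K -> stable S -> K :&: S = set0 ->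
  induced_free Gamma G ->
  vc_bounded
    (fun (x : {x | x \in K}) (y : {y | y \in S}) => ~~ adj (val x) (val y))
    #|Gamma|.
Proof.
move=> cK0 sK0 cK sS disjKS freeG X /enum_embedding[e inj_e eX].
apply/negP => /shatters_tracesP sh.
(* The points [e u] with [u] outside [K0] are spare: the pattern [u == v] on them makes [s]
   injective outside [K0]. *)
have /fin_all_exists[s sP] (v : Gamma) : exists s : {y | y \in S}, forall u,
    adj (val (e u)) (val s) = if u \in K0 then adj u v else u == v.
  have [s sX] := sh [set e u | u in
    [pred u | ~~ (if u \in K0 then adj u v else u == v)]].
  exists s => u; have := sX _ (eX u); rewrite mem_imset // inE.
  by move/(can_inj negbK).
pose f u := if u \in K0 then val (e u) else val (s u).
apply: (@split_embedding Gamma G K0 K S f) freeG => // [u v|u|u v].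
- rewrite /f; have [uK0 | uK0] := boolP (u \in K0);
  have [vK0 | vK0] := boolP (v \in K0) => eq_f.
  + exact/inj_e/val_inj.
  + by case: (disjoint_sets_absurd disjKS (x := val (e u)));
      [exact: valP | rewrite eq_f; exact: valP].
  + by case: (disjoint_sets_absurd disjKS (x := val (e v)));
      [exact: valP | rewrite -eq_f; exact: valP].
  by have := sP v u; rewrite -eq_f sP (negPf uK0) eqxx => /esym/eqP.
- by rewrite /f; case: (u \in K0); [exact: (valP (e u)) | exact: (valP (s u))].
by rewrite inE /f => uK0 /negPf vK0; rewrite uK0 vK0 sP uK0.
Qed.

(** The dual construction, with the stable part on the shattered set. The double negation is
    [~~ r a b] for [r] the non-adjacency. *)
Lemma vc_stable (Gamma G : sgraph) (K0 : {set Gamma}) (K S : {set G}) :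
  clique K0 -> stable (~: K0) -> clique K -> stable S -> K :&: S = set0 ->
  induced_free Gamma G ->
  vc_bounded
    (fun (y : {y | y \in S}) (x : {x | x \in K}) => ~~ ~~ adj (val x) (val y))
    #|Gamma|.
Proof.
move=> cK0 sK0 cK sS disjKS freeG X /enum_embedding[e inj_e eX].
apply/negP => /shatters_tracesP sh.
have /fin_all_exists[k kP] (v : Gamma) : exists k : {x | x \in K}, forall u,
    adj (val k) (val (e u)) = if u \in K0 then u == v else adj v u.
  have [k kX] := sh [set e u | u in
    [pred u | if u \in K0 then u == v else adj v u]].
  by exists k => u; have := kX _ (eX u); rewrite mem_imset // inE negbK.
pose f u := if u \in K0 then val (k u) else val (e u).
apply: (@split_embedding Gamma G K0 K S f) freeG => // [u v|u|u v].
- rewrite /f; have [uK0 | uK0] := boolP (u \in K0);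
  have [vK0 | vK0] := boolP (v \in K0) => eq_f.
  + by have := kP v u; rewrite -eq_f kP uK0 eqxx => /esym/eqP.
  + by case: (disjoint_sets_absurd disjKS (x := val (k u)));
      [exact: valP | rewrite eq_f; exact: valP].
  + by case: (disjoint_sets_absurd disjKS (x := val (k v)));
      [exact: valP | rewrite -eq_f; exact: valP].
  exact/inj_e/val_inj.
- by rewrite /f; case: (u \in K0); [exact: (valP (k u)) | exact: (valP (e u))].
by rewrite inE /f => uK0 /negPf vK0; rewrite uK0 vK0 kP vK0.
Qed.

(** * The separator and its size *)

Theorem theorem6 (Gamma : sgraph) (hGamma : split_graph Gamma) :
  exists Q : {poly int},
    forall G : sgraph, induced_free Gamma G ->
      exists F : {set {set G} * {set G}},
        CS_separator F /\ (#|F|%:Z <= Q.[#|G|%:Z])%R.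
Proof.
have [m domP] := bounded_domination #|Gamma|.
(* Two cuts for each set of at most [m] vertices, of which there are at most [(n + 1)^m]. *)
exists (2%:P * ('X + 1) ^+ m)%R => G freeG.
have [K0 [S0 [cK0 sS0 KUS KIS]]] := hGamma.
have {KUS KIS} defS0 : S0 = ~: K0.
  apply/setP=> u; have := in_setT u; have := in_set0 u; rewrite -KUS -KIS !inE.
  by case: (u \in K0) (u \in S0) => [] [].
rewrite {S0}defS0 in sS0.
pose small := [set T : {set G} | #|T| <= m].
pose cutK (T : {set G}) := [set x | [forall k in T, (x == k) || adj x k]].
pose cutS (T : {set G}) := [set x | [exists s in T, adj x s]].
pose pair (U : {set G}) := (U, ~: U).
exists ([set pair (cutK T) | T in small] :|: [set pair (cutS T) | T in small]).
split; last first.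
  apply: (@le_trans _ _ ((2 * #|G|.+1 ^ m)%N%:Z)%R).
    rewrite lez_nat; apply: leq_trans (leq_card_setU _ _) _.
    rewrite mul2n -addnn; apply: leq_add;
    exact: leq_trans (leq_imset_card _ _) (card_small_sets _ _).
  rewrite !hornerE le_eqVlt; apply/orP; left; apply/eqP.
  by rewrite -natz natrM natrX -[#|G|.+1]addn1 natrD !natz.
split=> [_ /setUP[] /imsetP[T _ ->] | K S cK sS disjKS].
- by split; rewrite ?setUCr ?setICr.
- by split; rewrite ?setUCr ?setICr.
have notKS x : x \in K -> x \in S -> False by apply: disjoint_sets_absurd.
have := domP _ _ _ (vc_clique cK0 sS0 cK sS disjKS freeG)
  (vc_stable cK0 sS0 cK sS disjKS freeG).
case=> [[X leXm hitX] | [Y leYm hitY]].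
  (* [X] lies in the clique [K], so [K] is in its common closed neighbourhood; each vertex of [S]
     has a non-neighbour in [X] and is outside. *)
  exists (pair (cutK (val @: X))).
    apply/setUP; left; apply/imsetP; exists (val @: X) => //.
    by rewrite inE (leq_trans (leq_imset_card _ _)).
  split; apply/subsetP=> x xK; rewrite !inE.
    apply/forall_inP => _ /imsetP[k _ ->].
    have [//|neq_xk /=] := eqVneq x (val k).
    by apply: cK neq_xk => //; exact: (valP k).
  have [k Xk nadj] := hitX (exist _ x xK).
  rewrite negb_forall_in; apply/exists_inP; exists (val k); first exact: imset_f.
  rewrite negb_or adj_sym nadj andbT; apply/eqP => eq_xk.
  by apply: (notKS x) => //; rewrite eq_xk; exact: (valP k).
(* Each vertex of [K] has a neighbour in [Y], whereas [S] is stable and contains [Y]. *)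
exists (pair (cutS (val @: Y))).
  apply/setUP; right; apply/imsetP; exists (val @: Y) => //.
  by rewrite inE (leq_trans (leq_imset_card _ _)).
split; apply/subsetP=> x xK; rewrite !inE.
  have [s Ys] := hitY (exist _ x xK); rewrite negbK /= => adj_xs.
  by apply/exists_inP; exists (val s); first exact: imset_f.
rewrite negb_exists_in; apply/forall_inP => _ /imsetP[s _ ->].
by apply: sS => //; exact: (valP s).
Qed.
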